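(* Let $\Sigma=\{a<b<c\}$. Suppose that $w=xacyca$ and $w'=xcayac$ for some $x,y\in\Sigma^\ast$. Then $[w]\equiv_M[w']$ if and only if $|y|_b(|x|_a-|x|_c)=|x|_b(|y|_a-|y|_c)$.
   Context: $\Sigma^\ast$ is the set of all finite words over $\Sigma$, including the empty word $\lambda$; juxtaposition denotes concatenation. For a letter $d\in\Sigma$, $|x|_d$ is the number of occurrences of $d$ in $x$. $\Sigma=\{a<b<c\}$ denotes an ordered alphabet with three distinct letters and order $a<b<c$. Cyclic shifts: for $w=c_1c_2\cdots c_n$ (letters $c_i$) and $0\le i\le n-1$, the $i$-th cyclic shift of $w$ is $c_{i+1}\cdots c_nc_1\cdots c_i$. The circular word $[w]$ is the set (equivalence class) of all distinct words that are cyclic shifts of $w$ (with $[\lambda]=\{\lambda\}$); $|[w]|$ is its cardinality. Parikh matrix of a linear word: for an ordered alphabet $\Sigma=\{a_1<a_2<\cdots<a_s\}$, $\Psi_\Sigma$ is the monoid morphism from $\Sigma^\ast$ to the $(s+1)\times(s+1)$ matrices under multiplication such that $\Psi_\Sigma(\lambda)$ is the identity matrix and, for $1\le q\le s$, $\Psi_\Sigma(a_q)$ is the matrix with $1$'s on the main diagonal, a $1$ in position $(q,q+1)$, and $0$ elsewhere. Parikh matrix of a circular word: $\Psi_\Sigma([w])=\frac{1}{|[w]|}\sum_{u\in[w]}\Psi_\Sigma(u)$ (a matrix with rational entries). $M$-equivalence: $[w]\equiv_M[w']$ means $\Psi_\Sigma([w])=\Psi_\Sigma([w'])$. *)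

(* Defs.v *)
From mathcomp Require Import all_boot all_order all_algebra finmap.

Set Implicit Arguments.
Unset Strict Implicit.
Unset Printing Implicit Defensive.

Import GRing.Theory.
Local Open Scope ring_scope.
Local Open Scope fset_scope.

(* The ordered alphabet a_1 < ... < a_s is 'I_s with its natural order; the
   letter a_q is the ordinal q - 1. *)
Notation word s := (seq 'I_s).

(* A 1 in position (q, q + 1): the row is the letter itself and the column its
   successor, both among the s + 1 indices. *)
Definition parikh_letter (s : nat) (q : 'I_s) : 'M[rat]_s.+1 :=
  1 + delta_mx (widen_ord (leqnSn s) q) (lift ord0 q).

Definition parikh (s : nat) (u : word s) : 'M[rat]_s.+1 :=
  \prod_(q <- u) parikh_letter q.

Lemma parikh_cat s (u v : word s) : parikh (u ++ v) = parikh u * parikh v.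
Proof. exact: big_cat. Qed.

(* The range includes i = size w, for which rot i w = w: this adds nothing to
   a nonempty word, and makes the class of the empty word a singleton. *)
Definition circular (s : nat) (w : word s) : {fset word s} :=
  [fset rot i w | i in iota 0 (size w).+1].

Lemma circular_nil s : circular ([::] : word s) = [fset [::]].
Proof.
apply/fsetP=> u; rewrite inE; apply/imfsetP/eqP => [[i _ ->] //|->].
by exists 0%N.
Qed.

Lemma circular_neq_nil s (w : word s) : w != [::] ->
  circular w = [fset rot i w | i in iota 0 (size w)].
Proof.
move=> w_neq0; apply/fsetP=> u; apply/imfsetP/imfsetP => -[i lti ->].
  have : i \in iota 0 (size w).+1 by [].
  rewrite mem_iota leq0n add0n ltnS [(i <= _)%N]leq_eqVlt => /orP[/eqP->|{}lti].
    exists 0%N; last by rewrite rot0 rot_size.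
    by case: (w) w_neq0.
  by exists i => //; change (i \in iota 0 (size w)); rewrite mem_iota.
exists i => //; move: lti.
suff : i \in iota 0 (size w) -> i \in iota 0 (size w).+1 by [].
by rewrite !mem_iota !leq0n !add0n; apply: leqW.
Qed.

Definition circular_parikh (s : nat) (W : {fset word s}) : 'M[rat]_s.+1 :=
  (#|` W|%:R)^-1 *: \sum_(u <- W) parikh u.

Definition M_equiv (s : nat) (W W' : {fset word s}) : Prop :=
  circular_parikh W = circular_parikh W'.

Definition a : 'I_3 := @Ordinal 3 0 isT.
Definition b : 'I_3 := @Ordinal 3 1 isT.
Definition c : 'I_3 := @Ordinal 3 2 isT.

(* An integer, so that differences of occurrence counts are not truncated. *)
Definition occ (s : nat) (d : 'I_s) (x : word s) : int := (count_mem d x)%:Z.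

(* Main.v *)
Require Import Defs.
From mathcomp Require Import all_boot all_order all_algebra finmap.
From mathcomp Require Import ring.

(** Averaging over a circular word is the same as averaging over all [n]
    rotations of a word of length [n], since every member of the class arises
    from the same number of shifts ([circular_parikh_rotations]). The two words
    have the same length, so the theorem compares two sums of Parikh matrices
    over rotations.

    Write [A], [C] for the matrices of the letters a, c, and [X], [Y] for those
    of the words x, y. As a and c are not adjacent letters, [A] and [C] commute;
    put [T = A C = C A]. A rotation is a choice of a cut point. If the cut falls
    inside x or y, or at the start of one of the four blocks, then ac and ca
    both stay unbroken and each may be replaced by the other: the rotations of w
    and w' with that cut have the same matrix. Only the cuts inside the blocks
    ac and ca remain, and they leave the difference
    [[
      (C (Y T X) A + A (X T Y) C) - (A (Y T X) C + C (X T Y) A)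
        = A K C - C K A,   where K = X T Y - Y T X.
    ]]
    Exchanging the factors X and Y does not change the number of occurrences of
    letters, so [K] vanishes below its second superdiagonal
    ([skip_commutator]). For such a [K] only the corner entry of the difference
    can be nonzero, and it is the sum of the two entries of [K] that compare the
    numbers of subwords ab and bc ([conj_letters_ac]). Counting these in the
    concatenations ([parikh_cat_skip]) turns that entry into
    [[
      |y|_b (|x|_a - |x|_c) - |x|_b (|y|_a - |y|_c).
    ]] *)

Set Implicit Arguments.
Unset Strict Implicit.
Unset Printing Implicit Defensive.

Import GRing.Theory Num.Theory.
Local Open Scope ring_scope.

(** * Rotations of a word *)

Definition rotations (T : Type) (w : seq T) : seq (seq T) :=
  [seq rot i w | i <- iota 0 (size w)].

(** Only the first rotation of [w], which is [w] itself, leaves the front of the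
    list, and it comes back at the end as the full turn. *)
Lemma rotations_rot1 (T : eqType) (w : seq T) :
  perm_eq (rotations (rot 1 w)) (rotations w).
Proof.
rewrite /rotations size_rot; case def_n: (size w) => [|m] //.
have -> : [seq rot i (rot 1 w) | i <- iota 0 m.+1]
        = [seq rot i w | i <- iota 1 m.+1].
  rewrite (iotaDl 1 0) -map_comp; apply/eq_in_map => i.
  by rewrite mem_iota -def_n => /andP[_ lt_i]; rewrite /= rot_rot -rotS.
have -> : iota 1 m.+1 = rcons (iota 1 m) m.+1.
  by rewrite -[X in iota 1 X]addn1 iotaD cats1.
by rewrite map_rcons -def_n rot_size def_n perm_rcons /= rot0.
Qed.

Lemma rotations_rot (T : eqType) (j : nat) (w : seq T) :
  perm_eq (rotations (rot j w)) (rotations w).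
Proof.
elim: j => [|j IHj]; first by rewrite rot0.
have [lt_jw | le_wj] := ltnP j (size w).
  by rewrite rotS // (permPl (rotations_rot1 _)).
by rewrite rot_oversize // ltnW.
Qed.

(** Rotating by [j] permutes the rotations of [w], so it carries the occurrences
    of [w] among them to the occurrences of [rot j w]: every member of a
    circular word is hit by the same number of shifts. *)
Lemma count_rotations (T : eqType) (j : nat) (w : seq T) :
  count_mem (rot j w) (rotations w) = count_mem w (rotations w).
Proof.
rewrite -(permP (rotations_rot j w)) /rotations size_rot.
rewrite (eq_map (g := rot j \o rot^~ w)) => [|i]; last by rewrite /= rot_rot.
rewrite map_comp count_map; apply: eq_count => u /=.
by rewrite (inj_eq (@rot_inj j _)).
Qed.

Lemma perm_circular s (w : word s) : w != [::] ->
  perm_eq (circular w) (undup (rotations w)).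
Proof.
move=> w_neq0; apply: uniq_perm; rewrite ?fset_uniq ?undup_uniq // => u.
rewrite circular_neq_nil // mem_undup.
by apply/imfsetP/mapP => -[i lt_i ->]; exists i.
Qed.

(** The rotations of [w] run through its circular word with the constant
    multiplicity given by [count_rotations]. *)
Lemma sum_rotations s (V : nmodType) (F : word s -> V) (w : word s) :
  w != [::] ->
  \sum_(u <- rotations w) F u
    = (\sum_(u <- circular w) F u) *+ count_mem w (rotations w).
Proof.
move=> w_neq0; rewrite (perm_big _ (perm_circular w_neq0)) -sumrMnl.
rewrite -big_undup_iterop_count big_seq [RHS]big_seq.
apply: eq_bigr => u; rewrite mem_undup => /mapP[j _ ->].
by rewrite count_rotations.
Qed.

Lemma circular_parikh_rotations s (w : word s) : w != [::] ->
  circular_parikh (circular w)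
    = (size w)%:R^-1 *: \sum_(u <- rotations w) parikh u.
Proof.
move=> w_neq0.
have card_w : (size w = #|` circular w| * count_mem w (rotations w))%N.
  have := sum_rotations (fun=> 1%N) w_neq0.
  rewrite !sum1_size size_map size_iota => ->.
  by rewrite -mulr_natr natn.
have n_neq0 : (size w)%:R != 0 :> rat by rewrite pnatr_eq0 size_eq0.
rewrite sum_rotations // card_w -scaler_nat scalerA; congr (_ *: _).
move: n_neq0; rewrite card_w natrM mulf_eq0 negb_or => /andP[? ?].
by rewrite invfM mulfVK.
Qed.

(** * Rotations cut inside a factor *)

(** The sum, over the cut points of a factor [u] of a circular word, of the
    Parikh matrix of the word read from that cut; [M] stands for the matrix of
    the rest of the circle, read from the end of [u] back to its start. A cut at
    the start of [u] is included and one at its end is not, so that consecutive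
    factors share no cut. *)
Definition cut_sum s (u : word s) (M : 'M[rat]_s.+1) : 'M[rat]_s.+1 :=
  \sum_(i < size u) parikh (drop i u) * M * parikh (take i u).

(** A cut inside one of two consecutive factors leaves the other one whole, as
    a part of the rest of the circle. *)
Lemma cut_sum_cat s (u v : word s) M :
  cut_sum (u ++ v) M
    = cut_sum u (parikh v * M) + cut_sum v (M * parikh u).
Proof.
rewrite /cut_sum size_cat big_split_ord /=; congr (_ + _); apply: eq_bigr => i _.
  by rewrite drop_cat take_cat ltn_ord parikh_cat !mulrA.
by rewrite drop_cat take_cat ltnNge leq_addr /= addKn parikh_cat !mulrA.
Qed.

Lemma cut_sum_rotations s (w : word s) :
  \sum_(u <- rotations w) parikh u = cut_sum w 1.
Proof.
have -> : rotations w = [seq rot i w | i <- index_iota 0 (size w)].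
  by rewrite /index_iota subn0.
rewrite big_map big_mkord.
by apply: eq_bigr => i _; rewrite mulr1 parikh_cat.
Qed.

Lemma cut_sum_pair s (d e : 'I_s) M :
  cut_sum [:: d; e] M
    = parikh [:: d; e] * M + parikh_letter e * M * parikh_letter d.
Proof.
by rewrite /cut_sum !big_ord_recl big_ord0 /= /parikh !big_cons big_nil !mulr1 addr0.
Qed.

(** * Entries of Parikh matrices near the diagonal *)

(* The matrix of a letter d has its off-diagonal 1 in row [row_of d] and column
   [col_of d]; more generally the entry (row_of d, col_of e) of a Parikh matrix
   counts the occurrences of the subword d ... e of consecutive letters. *)
Local Notation row_of d := (widen_ord (leqnSn _) d).
Local Notation col_of d := (lift ord0 d).

Lemma delta_mxMl n (p q i j : 'I_n.+1) (M : 'M[rat]_n.+1) :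
  (delta_mx p q * M) i j = (i == p)%:R * M q j.
Proof.
rewrite mxE (bigD1 q) //= mxE eqxx andbT [X in _ + X]big1 ?addr0 // => k neq_k.
by rewrite mxE (negPf neq_k) andbF mul0r.
Qed.

Lemma delta_mxMr n (p q i j : 'I_n.+1) (M : 'M[rat]_n.+1) :
  (M * delta_mx p q) i j = M i p * (j == q)%:R.
Proof.
rewrite mxE (bigD1 p) //= mxE eqxx [X in _ + X]big1 ?addr0 // => k neq_k.
by rewrite mxE (negPf neq_k) mulr0.
Qed.

(** Left multiplication by the matrix of a letter is an elementary row
    operation; the entries near the diagonal are computed by induction along it. *)
Lemma parikh_cons_entry s (d : 'I_s) (u : word s) (i j : 'I_s.+1) :
  parikh (d :: u) i j
    = parikh u i j + (i == row_of d)%:R * parikh u (col_of d) j.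
Proof.
by rewrite /parikh big_cons mulrDl mul1r mxE delta_mxMl.
Qed.

Lemma parikh_nil_entry s (i j : 'I_s.+1) :
  parikh ([::] : word s) i j = (i == j)%:R.
Proof. by rewrite /parikh big_nil mxE. Qed.

Lemma parikh_lower s (u : word s) (i j : 'I_s.+1) :
  (j <= i)%N -> parikh u i j = (i == j)%:R.
Proof.
elim: u i j => [|d u IHu] i j le_ji; first exact: parikh_nil_entry.
rewrite parikh_cons_entry IHu //; case: (eqVneq i (row_of d)) => [def_i|_].
  have lt_j : (j < col_of d)%N by rewrite lift0 ltnS; rewrite def_i in le_ji.
  by rewrite IHu 1?ltnW // -[col_of d == j]val_eqE gtn_eqF // mulr0 addr0.
by rewrite mul0r addr0.
Qed.

Lemma parikh_superdiag s (d : 'I_s) (u : word s) :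
  parikh u (row_of d) (col_of d) = (count_mem d u)%:R.
Proof.
elim: u => [|e u IHu].
  by rewrite parikh_nil_entry -val_eqE /= /bump /= ltn_eqF.
rewrite parikh_cons_entry IHu /= natrD addrC; congr (_ + _).
rewrite -val_eqE /= eq_sym val_eqE; case: eqP => [->|_]; last by rewrite mul0r.
by rewrite mul1r parikh_lower // eqxx.
Qed.

(** The entry counts the subwords de, and such a subword of [u ++ v] lies in [u],
    or in [v], or takes its d from [u] and its e from [v]. *)
Lemma parikh_cat_skip s (d e : 'I_s) (u v : word s) : e = d.+1 :> nat ->
  parikh (u ++ v) (row_of d) (col_of e)
    = parikh u (row_of d) (col_of e) + parikh v (row_of d) (col_of e)
      + (count_mem d u)%:R * (count_mem e v)%:R.
Proof.
move=> def_e; elim: u => [|f u IHu].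
  by rewrite parikh_nil_entry -val_eqE /= /bump /= def_e ltn_eqF // mul0r addr0 add0r.
rewrite !parikh_cons_entry IHu /= natrD -val_eqE /= eq_sym val_eqE.
case: eqP => [->|_] /=; last by ring.
have -> : col_of d = row_of e by apply: val_inj; rewrite /= def_e.
by rewrite !parikh_superdiag count_cat natrD; ring.
Qed.

(** The entries up to the first superdiagonal depend only on the numbers of
    occurrences of the letters, which are the same in both words. *)
Lemma skip_commutator s (u t v : word s) (i j : 'I_s.+1) :
  (j <= i.+1)%N -> (parikh (u ++ t ++ v) - parikh (v ++ t ++ u)) i j = 0.
Proof.
rewrite leq_eqVlt ltnS => /orP[/eqP def_j | le_ji]; last first.
  by rewrite !mxE !parikh_lower // subrr.
have lt_i : (i < s)%N by rewrite -ltnS -def_j.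
have -> : i = row_of (Ordinal lt_i) by apply: val_inj.
have -> : j = col_of (Ordinal lt_i) by apply: ord_inj; rewrite def_j lift0.
by rewrite !mxE !parikh_superdiag !count_cat !natrD; ring.
Qed.

(** * The letters a and c *)

Local Notation A := (parikh_letter a).
Local Notation C := (parikh_letter c).

(** The two off-diagonal units are in positions (0, 1) and (2, 3), so their
    products in both orders vanish. *)
Lemma parikh_ac_comm : parikh [:: a; c] = parikh [:: c; a].
Proof.
rewrite /parikh !big_cons big_nil !mulr1 /parikh_letter !mulrDl !mulrDr !mul1r !mulr1.
rewrite -!mulmxE !mul_delta_mx_0 // !addr0 -!addrA.
by congr (_ + _); rewrite addrC.
Qed.

(** Under the hypothesis on [K], multiplying by [A] on the left or by [C] on the
    right adds one entry of the second superdiagonal to the corner, whereas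
    multiplying by [A] on the right or by [C] on the left has no effect. *)
Lemma conj_letters_ac (K : 'M[rat]_4) :
  (forall i j : 'I_4, (j <= i.+1)%N -> K i j = 0) ->
  A * K * C - C * K * A
    = (K (row_of a) (col_of b) + K (row_of b) (col_of c))
        *: delta_mx (row_of a) (col_of c).
Proof.
move=> K0; set E := delta_mx (row_of a) (col_of c).
have letters_eq : (row_of b = col_of a :> 'I_4) * (row_of c = col_of b :> 'I_4).
  by split; apply: val_inj.
have AK : A * K = K + K (row_of b) (col_of c) *: E.
  rewrite mulrDl mul1r; congr (_ + _); apply/matrixP => i j.
  rewrite delta_mxMl mxE mxE -letters_eq.
  case: (i == _); last by rewrite !mul0r mulr0.
  have [-> | neq_j] := eqVneq j (col_of c); first by rewrite mul1r mulr1.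
  rewrite mulr0 mul1r K0 //= -ltnS ltn_neqAle -ltnS ltn_ord andbT.
  by rewrite -[2%N.+1]/(val (col_of c)) val_eqE.
have KC : K * C = K + K (row_of a) (col_of b) *: E.
  rewrite mulrDr mulr1; congr (_ + _); apply/matrixP => i j.
  rewrite delta_mxMr mxE mxE letters_eq.
  have [-> | neq_i] := eqVneq i (row_of a); first by [].
  by rewrite mulr0 K0 ?mul0r //= ltnS lt0n -[0%N]/(val (row_of a)) val_eqE.
have KA : K * A = K.
  rewrite mulrDr mulr1; apply/matrixP => i j.
  by rewrite mxE delta_mxMr [K i (row_of a)]K0 // mul0r addr0.
have CK : C * K = K.
  rewrite mulrDl mul1r; apply/matrixP => i j.
  by rewrite mxE delta_mxMl [K (col_of c) j]K0 ?mulr0 ?addr0 // ltnW.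
have EC : E * C = E.
  by rewrite mulrDr mulr1 -mulmxE mul_delta_mx_0 ?addr0.
by rewrite AK CK KA mulrDl KC -scalerAl EC scalerDl addrC addrA addKr.
Qed.

Theorem theorem5p4 (x y w w' : word 3)
    (hw : w = x ++ [:: a; c] ++ y ++ [:: c; a])
    (hw' : w' = x ++ [:: c; a] ++ y ++ [:: a; c]) :
  M_equiv (circular w) (circular w') <->
  occ b y * (occ a x - occ c x) = occ b x * (occ a y - occ c y).
Proof.
have w_neq0 : w != [::] by rewrite hw -size_eq0 !size_cat /= addnCA.
have w'_neq0 : w' != [::] by rewrite hw' -size_eq0 !size_cat /= addnCA.
have eq_size : size w' = size w by rewrite hw hw' !size_cat.
have n_neq0 : (size w)%:R^-1 != 0 :> rat by rewrite invr_eq0 pnatr_eq0 size_eq0.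
pose K := parikh (x ++ [:: a; c] ++ y) - parikh (y ++ [:: a; c] ++ x).
have diffE : cut_sum w 1 - cut_sum w' 1 = A * K * C - C * K * A.
  rewrite hw hw' !cut_sum_cat !cut_sum_pair /K !parikh_cat -parikh_ac_comm.
  set T := parikh [:: a; c]; rewrite !mul1r !mulr1 !mulrBr !mulrBl !mulrA.
  (* Cuts inside x or y and cuts before the blocks ac and ca cancel in pairs. *)
  have cancel (V : zmodType) (u v z : V) : (u + v) - (u + z) = v - z.
    by rewrite opprD addrACA subrr add0r.
  rewrite cancel opprD addrACA !cancel opprB [RHS]addrACA [LHS]addrACA.
  by rewrite [X in X + _ = _]addrC.
have K_skip : forall i j : 'I_4, (j <= i.+1)%N -> K i j = 0.
  exact: skip_commutator.
pose delta : int :=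
  occ b y * (occ a x - occ c x) - occ b x * (occ a y - occ c y).
have cornerE : K (row_of a) (col_of b) + K (row_of b) (col_of c) = delta%:~R.
  rewrite /K !mxE !parikh_cat_skip // /delta /occ.
  rewrite !(rmorphB, rmorphM) /= -!pmulrn !natrD.
  by ring.
rewrite /M_equiv !circular_parikh_rotations // eq_size !cut_sum_rotations.
split=> [eq_w | eq_delta].
  apply/eqP; rewrite -subr_eq0 -(intr_eq0 rat) -/delta -cornerE.
  have /eqP := scalerI n_neq0 eq_w.
  rewrite -subr_eq0 diffE conj_letters_ac // => /eqP/matrixP.
  by move=> /(_ (row_of a) (col_of c)); rewrite !mxE !eqxx mulr1 => ->.
congr (_ *: _); apply/eqP; rewrite -subr_eq0 diffE conj_letters_ac // cornerE.
by rewrite /delta eq_delta subrr scale0r.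
Qed.
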